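(* Work in the axiomatic setting described in the context. Let $\mathcal Z$ be a zigzag of homomorphisms with nodes $X_0,X_1,\dots,X_n$. Suppose that the largest and smallest subgroups are preserved by chasing them from each end node of $\mathcal Z$ to the opposite end node; that is, chasing forward along $\mathcal Z$ takes the smallest subgroup of $X_0$ to the smallest subgroup of $X_n$ and the largest subgroup of $X_0$ to the largest subgroup of $X_n$, and chasing backward along $\mathcal Z$ takes the smallest subgroup of $X_n$ to the smallest subgroup of $X_0$ and the largest subgroup of $X_n$ to the largest subgroup of $X_0$. Then $\mathcal Z$ induces a homomorphism $X_0\to X_n$, and this induced homomorphism is an isomorphism.
   Context: **Axiomatic setting.** The words ''group'', ''homomorphism'', ''subgroup'' are primitive notions (ordinary groups are only one model). The data are: groups; homomorphisms $f\colon X\to Y$ between groups, with a composition; for each group $G$ a collection $\mathrm{Sub}\,G$ of subgroups of $G$ with a relation $\subseteq$; and for each homomorphism $f\colon X\to Y$ a direct image map $A\mapsto fA$, $\mathrm{Sub}\,X\to \mathrm{Sub}\,Y$, and an inverse image map $B\mapsto f^{-1}B$, $\mathrm{Sub}\,Y\to\mathrm{Sub}\,X$. The following axioms are assumed. Axiom 1. Groups and homomorphisms form a category (with identities $1_G$); each $(\mathrm{Sub}\,G,\subseteq)$ is a poset; $fA\subseteq B\Leftrightarrow A\subseteq f^{-1}B$ for all $f\colon X\to Y$, $A\in\mathrm{Sub}\,X$, $B\in\mathrm{Sub}\,Y$; the direct and inverse image maps of $1_G$ are identity maps, and $f(gA)=(fg)A$, $g^{-1}(f^{-1}B)=(fg)^{-1}B$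 for composable $f,g$. Axiom 2. Each $\mathrm{Sub}\,G$ is a bounded lattice, with meet $\wedge$, join $\vee$, smallest (trivial) element denoted $1$ and largest element denoted $G$. For $f\colon X\to Y$ put $\mathrm{Im} f=fX$ (direct image of the largest subgroup) and $\mathrm{Ker} f=f^{-1}1$ (inverse image of the trivial subgroup). Then $ff^{-1}B=B\wedge\mathrm{Im} f$ and $f^{-1}fA=A\vee\mathrm{Ker} f$ for all $A\in\mathrm{Sub}\,X$, $B\in\mathrm{Sub}\,Y$. A subgroup of $G$ is *normal* if it equals $\mathrm{Ker} f$ for some homomorphism $f\colon G\to H$, and *conormal* if it equals $\mathrm{Im} f$ for some homomorphism $f\colon F\to G$. An *embedding associated to* a subgroup $S$ of $G$ is a homomorphism $m\colon M\to G$ with $\mathrm{Im}\, m\subseteq S$ such that every $m'\colon M'\to G$ with $\mathrm{Im}\, m'\subseteq S$ factors as $m'=mu$ for a unique $u$. Dually, a *projection associated to* $S$ is a homomorphism $e\colon G\to E$ with $S\subseteq \mathrm{Ker}\, e$ such that every $e'\colon G\to E'$ with $S\subseteq\mathrm{Ker}\, e'$ factors as $e'=ve$ for a unique $v$. An embedding (projection) is one associated to some subgroup. Axiom 3. Each conormal subgroup $S$ of $G$ has an associated embedding $\iota_S\colon S/1\to G$, and each normal subgroup $S$ of $G$ has an associated projection $\pi_S\colon G\to G/S$ (fixed choices, with $\iota_G=1_G$ for the largest subgroup and $\pi_1=1_G$ for the trivial subgroup). Axiom 4. Every homomorphism $f\colon X\to Y$ factorizes as $f=\iota_{\mathrm{Im}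 f}\,h\,\pi_{\mathrm{Ker} f}$ with $h$ an isomorphism. Axiom 5. The join of two normal subgroups of a group is normal, and the meet of two conormal subgroups of a group is conormal. **Zigzags and chasing.** A zigzag with nodes $X_0,\dots,X_n$ ($n\ge 1$) consists of homomorphisms $f_1,\dots,f_n$, where each $f_i$ is either right-pointing, $f_i\colon X_{i-1}\to X_i$, or left-pointing, $f_i\colon X_i\to X_{i-1}$. Chasing a subgroup $S$ of $X_0$ forward along the zigzag yields the subgroup $f_n^*\cdots f_1^*S$ of $X_n$, where $f_i^*$ is the direct image map of $f_i$ if $f_i$ is right-pointing and the inverse image map of $f_i$ if $f_i$ is left-pointing. Chasing a subgroup of $X_n$ backward means chasing it along the reversed zigzag: one successively applies, for $i=n,\dots,1$, the inverse image map of $f_i$ if $f_i$ is right-pointing and the direct image map of $f_i$ if $f_i$ is left-pointing. A zigzag is *collapsible* if all its left-pointing arrows are isomorphisms; the homomorphism induced by a collapsible zigzag is the composite $X_0\to X_n$ of the right-pointing arrows and the inverses of the left-pointing ones. **Pyramid of a zigzag.** It has nodes $X^j_i$, $0\le i\le j\le n$, with $X^i_i=X_i$. For $i<j$ the node $X_i^j$ has lower-left neighbour $X_i^{j-1}$ and lower-right neighbour $X_{i+1}^j$; neighbours are joined by one homomorphism, pointing either upward (then it is a projection) or downward (then it is an embedding). It is built bottom-up. Base: for each $i$, factor $f_i=me$ with $e$ a projection associated to $\mathrm{Ker} f_i$ and $m$ an embedding associated to $\mathrm{Im} f_i$; $X^i_{i-1}$ is the codomain of $e$ (the domain of $m$),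 $e$ is the upward edge from the domain of $f_i$ and $m$ the downward edge to the codomain of $f_i$. Step: given the bottom wedge formed by the edges joining $X^i_j$ (with $1\le j\le i\le n-1$) to $X^i_{j-1}$ and to $X^{i+1}_j$, construct $X^{i+1}_{j-1}$ and its edges to $X^i_{j-1}$ and $X^{i+1}_j$ as follows. - If both edges of the wedge point upward, $a\colon X^i_j\to X^i_{j-1}$ and $b\colon X^i_j\to X^{i+1}_j$, let $p\colon X^i_j\to X^{i+1}_{j-1}$ be a projection associated to $\mathrm{Ker}\,a\vee\mathrm{Ker}\,b$; the new edges are the homomorphisms $x\colon X^i_{j-1}\to X^{i+1}_{j-1}$ and $y\colon X^{i+1}_j\to X^{i+1}_{j-1}$ with $xa=p=yb$. - If both point downward, do the dual: $q\colon X^{i+1}_{j-1}\to X^i_j$ is an embedding associated to the meet of the images of the two wedge edges, and the new (downward) edges are the factorizations of $q$ through the two wedge edges. - If one edge of the wedge points downward into $X^i_j$ and the other upward out of $X^i_j$, form their composite $c$ (between $X^i_{j-1}$ and $X^{i+1}_j$), factor $c=m_2e_2$ with $e_2$ a projection associated to $\mathrm{Ker}\,c$ and $m_2$ an embedding associated to $\mathrm{Im}\,c$; $X^{i+1}_{j-1}$ is the codomain of $e_2$, and $e_2$ (upward), $m_2$ (downward) are the new edges. The pyramid is unique up to isomorphisms between corresponding nodes commuting with all edges. The *principal horizontal zigzag* is the zigzag $X^0_0,X^1_0,\dots,X^n_0,X^n_1,\dots,X^n_n$ along the two sides of the pyramid, read from $X_0=X_0^0$ to $X_n=X^n_n$.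 A zigzag *induces a homomorphism* if the principal horizontal zigzag of a pyramid constructed from it is collapsible; the homomorphism $X_0\to X_n$ induced by that collapsible zigzag is then called the *induced homomorphism* of the original zigzag (it does not depend on the chosen pyramid). *)

(* Defs.v *)
Set Implicit Arguments.
Unset Strict Implicit.
Unset Printing Implicit Defensive.

(* The primitive notions.  [comp g f] is "g after f", [direct f A] is the
   direct image fA and [inverse f B] the inverse image of B under f.
   [emb S : S/1 -> G] and [proj S : G -> G/S] are the fixed embeddings and
   projections; they are total functions whose values at non-conormal
   (respectively non-normal) subgroups are never constrained. *)
Record form : Type := Form {
  group : Type;
  hom : group -> group -> Type;
  idhom : forall G : group, hom G G;
  comp : forall X Y Z : group, hom Y Z -> hom X Y -> hom X Z;
  subgroup : group -> Type;
  subset : forall G : group, subgroup G -> subgroup G -> Prop;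
  meet : forall G : group, subgroup G -> subgroup G -> subgroup G;
  join : forall G : group, subgroup G -> subgroup G -> subgroup G;
  bot : forall G : group, subgroup G;
  top : forall G : group, subgroup G;
  direct : forall X Y : group, hom X Y -> subgroup X -> subgroup Y;
  inverse : forall X Y : group, hom X Y -> subgroup Y -> subgroup X;
  emb_dom : forall G : group, subgroup G -> group;
  emb : forall (G : group) (S : subgroup G), hom (emb_dom S) G;
  proj_cod : forall G : group, subgroup G -> group;
  proj : forall (G : group) (S : subgroup G), hom G (proj_cod S)
}.

Arguments idhom {f} G : rename.
Arguments bot {f} G : rename.
Arguments top {f} G : rename.

Declare Scope form_scope.
Delimit Scope form_scope with form.
Notation "g * f" := (comp g f) : form_scope.
Notation "A <= B" := (subset A B) : form_scope.
Local Open Scope form_scope.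

Section Basic.
Variable F : form.

Definition Im (X Y : group F) (f : hom X Y) : subgroup Y := direct f (top X).
Definition Ker (X Y : group F) (f : hom X Y) : subgroup X := inverse f (bot Y).

Definition normal (G : group F) (S : subgroup G) : Prop :=
  exists (H : group F) (f : hom G H), S = Ker f.

Definition conormal (G : group F) (S : subgroup G) : Prop :=
  exists (E : group F) (f : hom E G), S = Im f.

Definition mutually_inverse (X Y : group F) (f : hom X Y) (g : hom Y X) : Prop :=
  g * f = idhom X /\ f * g = idhom Y.

Definition isomorphism (X Y : group F) (f : hom X Y) : Prop :=
  exists g : hom Y X, mutually_inverse f g.

Definition embedding_of (G : group F) (S : subgroup G)
    (M : group F) (m : hom M G) : Prop :=
  Im m <= S /\
  forall (M' : group F) (m' : hom M' G), Im m' <= S ->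
    exists! u : hom M' M, m' = m * u.

Definition projection_of (G : group F) (S : subgroup G)
    (E : group F) (e : hom G E) : Prop :=
  S <= Ker e /\
  forall (E' : group F) (e' : hom G E'), S <= Ker e' ->
    exists! v : hom E E', e' = v * e.

End Basic.

Record category_axioms (F : form) : Prop := {
  comp_assoc : forall (W X Y Z : group F) (h : hom Y Z) (g : hom X Y) (f : hom W X),
    h * (g * f) = (h * g) * f;
  comp_id_l : forall (X Y : group F) (f : hom X Y), idhom Y * f = f;
  comp_id_r : forall (X Y : group F) (f : hom X Y), f * idhom X = f;
  subset_refl : forall (G : group F) (A : subgroup G), A <= A;
  subset_trans : forall (G : group F) (A B C : subgroup G),
    A <= B -> B <= C -> A <= C;
  subset_antisym : forall (G : group F) (A B : subgroup G),
    A <= B -> B <= A -> A = B;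
  galois : forall (X Y : group F) (f : hom X Y) (A : subgroup X) (B : subgroup Y),
    direct f A <= B <-> A <= inverse f B;
  direct_id : forall (G : group F) (A : subgroup G), direct (idhom G) A = A;
  inverse_id : forall (G : group F) (A : subgroup G), inverse (idhom G) A = A;
  direct_comp : forall (X Y Z : group F) (f : hom Y Z) (g : hom X Y) (A : subgroup X),
    direct f (direct g A) = direct (f * g) A;
  inverse_comp : forall (X Y Z : group F) (f : hom Y Z) (g : hom X Y) (B : subgroup Z),
    inverse g (inverse f B) = inverse (f * g) B
}.

Record lattice_axioms (F : form) : Prop := {
  bot_least : forall (G : group F) (A : subgroup G), bot G <= A;
  top_greatest : forall (G : group F) (A : subgroup G), A <= top G;
  meet_glb : forall (G : group F) (A B C : subgroup G),
    C <= meet A B <-> C <= A /\ C <= B;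
  join_lub : forall (G : group F) (A B C : subgroup G),
    join A B <= C <-> A <= C /\ B <= C;
  direct_inverse : forall (X Y : group F) (f : hom X Y) (B : subgroup Y),
    direct f (inverse f B) = meet B (Im f);
  inverse_direct : forall (X Y : group F) (f : hom X Y) (A : subgroup X),
    inverse f (direct f A) = join A (Ker f)
}.

(* The normalizations iota_G = 1_G and pi_1 = 1_G compare homomorphisms with
   a priori different domains (codomains), hence the equalities of pairs. *)
Record choice_axioms (F : form) : Prop := {
  emb_embedding : forall (G : group F) (S : subgroup G),
    conormal S -> embedding_of S (emb S);
  proj_projection : forall (G : group F) (S : subgroup G),
    normal S -> projection_of S (proj S);
  emb_top : forall G : group F,
    existT (fun M => hom M G) (emb_dom (top G)) (emb (top G))
      = existT (fun M => hom M G) G (idhom G);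
  proj_bot : forall G : group F,
    existT (fun E => hom G E) (proj_cod (bot G)) (proj (bot G))
      = existT (fun E => hom G E) G (idhom G)
}.

Record noetherian_form (F : form) : Prop := {
  axiom1 : category_axioms F;
  axiom2 : lattice_axioms F;
  axiom3 : choice_axioms F;
  axiom4 : forall (X Y : group F) (f : hom X Y),
    exists h : hom (proj_cod (Ker f)) (emb_dom (Im f)),
      isomorphism h /\ f = emb (Im f) * (h * proj (Ker f));
  axiom5_join : forall (G : group F) (A B : subgroup G),
    normal A -> normal B -> normal (join A B);
  axiom5_meet : forall (G : group F) (A B : subgroup G),
    conormal A -> conormal B -> conormal (meet A B)
}.

Section Zigzags.
Variable F : form.

Inductive arrow (A B : group F) : Type :=
| rightw (f : hom A B)
| leftw (f : hom B A).

(* [zigzag X0 Xn]: the zigzags from X0 to Xn; [znil] has a single node. *)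
Inductive zigzag : group F -> group F -> Type :=
| znil (A : group F) : zigzag A A
| zcons (A B C : group F) (a : arrow A B) (Z : zigzag B C) : zigzag A C.

Fixpoint zlength (A B : group F) (Z : zigzag A B) : nat :=
  match Z with
  | znil _ => 0
  | zcons _ Z' => S (zlength Z')
  end.

Fixpoint zcat (A B C : group F) (Z : zigzag A B) : zigzag B C -> zigzag A C :=
  match Z with
  | znil _ => fun Z' => Z'
  | zcons a Z1 => fun Z' => zcons a (zcat Z1 Z')
  end.

Definition push (A B : group F) (a : arrow A B) : subgroup A -> subgroup B :=
  match a with rightw f => direct f | leftw f => inverse f end.

Definition pull (A B : group F) (a : arrow A B) : subgroup B -> subgroup A :=
  match a with rightw f => inverse f | leftw f => direct f end.

Fixpoint chase (A B : group F) (Z : zigzag A B) : subgroup A -> subgroup B :=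
  match Z with
  | znil _ => fun S => S
  | zcons a Z' => fun S => chase Z' (push a S)
  end.

Fixpoint chase_back (A B : group F) (Z : zigzag A B) : subgroup B -> subgroup A :=
  match Z with
  | znil _ => fun S => S
  | zcons a Z' => fun S => pull a (chase_back Z' S)
  end.

Fixpoint collapsible (A B : group F) (Z : zigzag A B) : Prop :=
  match Z with
  | znil _ => True
  | zcons a Z' =>
      match a with rightw _ => True | leftw f => isomorphism f end /\ collapsible Z'
  end.

Inductive composite : forall A B : group F, zigzag A B -> hom A B -> Prop :=
| composite_nil (A : group F) : composite (znil A) (idhom A)
| composite_rightw (A B C : group F) (f : hom A B) (Z : zigzag B C) (h : hom B C) :
    composite Z h -> composite (zcons (rightw f) Z) (h * f)
| composite_leftw (A B C : group F) (f : hom B A) (g : hom A B)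
    (Z : zigzag B C) (h : hom B C) :
    mutually_inverse f g -> composite Z h -> composite (zcons (leftw f) Z) (h * g).

(* [factorization a l r]: the homomorphism of the arrow a between A and B
   equals m e with e a projection associated to its kernel and m an embedding
   associated to its image; N is the middle object, drawn above A and B, l the
   edge on the side of A and r the one on the side of B.  All edges are read
   from left to right, so an edge l from A up to N is [rightw] when it points
   upward, whereas an edge r from N down to B is [rightw] when it points downward. *)
Inductive factorization (A N B : group F) :
    arrow A B -> arrow A N -> arrow N B -> Prop :=
| factorization_rightw (c : hom A B) (e : hom A N) (m : hom N B) :
    projection_of (Ker c) e -> embedding_of (Im c) m -> c = m * e ->
    factorization (rightw c) (rightw e) (rightw m)
| factorization_leftw (c : hom B A) (e : hom B N) (m : hom N A) :
    projection_of (Ker c) e -> embedding_of (Im c) m -> c = m * e ->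
    factorization (leftw c) (leftw m) (leftw e).

(* [square r l l' r']: one step of the construction of a pyramid,

               U
          l' /   \ r'
            T     C
           r \   / l
               B

   from the bottom wedge r, l to the top node U and the new edges l', r'. *)
Inductive square (T B C U : group F) :
    arrow T B -> arrow B C -> arrow T U -> arrow U C -> Prop :=
| square_up (a : hom B T) (b : hom B C) (p : hom B U) (x : hom T U) (y : hom C U) :
    projection_of (join (Ker a) (Ker b)) p -> x * a = p -> y * b = p ->
    square (leftw a) (rightw b) (rightw x) (leftw y)
| square_down (a : hom T B) (b : hom C B) (q : hom U B) (x : hom U T) (y : hom U C) :
    embedding_of (meet (Im a) (Im b)) q -> a * x = q -> b * y = q ->
    square (rightw a) (leftw b) (leftw x) (rightw y)
| square_right (a : hom T B) (b : hom B C) (l' : arrow T U) (r' : arrow U C) :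
    factorization (rightw (b * a)) l' r' -> square (rightw a) (rightw b) l' r'
| square_left (a : hom B T) (b : hom C B) (l' : arrow T U) (r' : arrow U C) :
    factorization (leftw (a * b)) l' r' -> square (leftw a) (leftw b) l' r'.

(* [strip r D D' r']: two adjacent parallel rising diagonals of a pyramid, for
   some i, together with all the edges joining them,

     D' = X_i^(i+1) - X_i^(i+2) - ... - X_i^n       (edges up-right)
     D  = X_(i+1)^(i+1) - X_(i+1)^(i+2) - ... - X_(i+1)^n

   where X_i^j is joined to X_(i+1)^j, r being the first of these edges
   (j = i+1) and r' the last one (j = n); every cell is a [square]. *)
Inductive strip : forall T B U C : group F,
    arrow T B -> zigzag B C -> zigzag T U -> arrow U C -> Type :=
| strip_nil (T B : group F) (r : arrow T B) : strip r (znil B) (znil T) r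
| strip_cons (T B C U C1 U1 : group F)
    (r : arrow T B) (l : arrow B C) (l' : arrow T U) (r' : arrow U C)
    (D : zigzag C C1) (D' : zigzag U U1) (r1 : arrow U1 C1) :
    square r l l' r' -> strip r' D D' r1 ->
    strip r (zcons l D) (zcons l' D') r1.

(* [pyramid Z L R]: the pyramids constructed from Z whose left side is
   L = X_0^0 - X_0^1 - ... - X_0^n and whose right side is
   R = X_0^n - X_1^n - ... - X_n^n.  A pyramid over X_0, ..., X_n is a pyramid
   over X_1, ..., X_n together with the diagonal X_0^0, ..., X_0^n: the edges
   at X_0^1 factorize the first arrow of Z, and the remaining nodes and edges
   form a strip along the left side X_1^1, ..., X_1^n of the smaller pyramid. *)
Inductive pyramid : forall A T B : group F,
    zigzag A B -> zigzag A T -> zigzag T B -> Type :=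
| pyramid_nil (A : group F) : pyramid (znil A) (znil A) (znil A)
| pyramid_cons (A N B C T U : group F)
    (f : arrow A B) (l : arrow A N) (r : arrow N B)
    (Z : zigzag B C) (L : zigzag B T) (R : zigzag T C)
    (L' : zigzag N U) (r' : arrow U T) :
    factorization f l r -> pyramid Z L R -> strip r L L' r' ->
    pyramid (zcons f Z) (zcons l L') (zcons r' R).

Definition principal (A T B : group F) (Z : zigzag A B)
    (L : zigzag A T) (R : zigzag T B) (P : pyramid Z L R) : zigzag A B :=
  zcat L R.

Definition induces_homomorphism (A B : group F) (Z : zigzag A B) : Prop :=
  exists (T : group F) (L : zigzag A T) (R : zigzag T B) (P : pyramid Z L R),
    collapsible (principal P).

Definition induced_homomorphism (A B : group F) (Z : zigzag A B) (h : hom A B) : Prop :=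
  exists (T : group F) (L : zigzag A T) (R : zigzag T B) (P : pyramid Z L R),
    collapsible (principal P) /\ composite (principal P) h.

End Zigzags.

(* Main.v *)
(** A pyramid replaces a wedge by two arrows over it through which chasing gives
    the same result, so chasing along the principal horizontal zigzag agrees with
    chasing along the original one.  The left side of a pyramid ascends and its
    right side descends: an upward edge has full image, a downward edge has trivial
    kernel.  Hence the left side preserves the extreme subgroups forward and the
    right side preserves them backward, and chasing is injective along the right
    side forward and along the left side backward.  If chasing along the whole
    zigzag preserves the extreme subgroups in both directions, injectivity forces
    every single edge to do so; such an edge has trivial kernel and full image, and
    by Axiom 4 it is an isomorphism. *)

From Stdlib Require Import Setoid.
Require Import Defs.

Set Implicit Arguments.
Unset Strict Implicit.
Unset Printing Implicit Defensive.

Section Noetherian.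
Local Open Scope form_scope.
Variables (F : form) (HF : noetherian_form F).

Let C1 := axiom1 HF.
Let C2 := axiom2 HF.
Let C3 := axiom3 HF.

(** * Subgroup lattices and the Galois connection *)

Lemma direct_mono (X Y : group F) (f : hom X Y) (A B : subgroup X) :
  A <= B -> direct f A <= direct f B.
Proof.
  intro H; apply (galois C1), (subset_trans C1 H), (galois C1), (subset_refl C1).
Qed.

Lemma inverse_mono (X Y : group F) (f : hom X Y) (A B : subgroup Y) :
  A <= B -> inverse f A <= inverse f B.
Proof.
  intro H; apply (galois C1); refine (subset_trans C1 _ H).
  apply (galois C1), (subset_refl C1).
Qed.

Lemma top_le_eq (G : group F) (A : subgroup G) : top G <= A -> A = top G.
Proof. intro H; apply (subset_antisym C1); [apply (top_greatest C2) | exact H]. Qed.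

Lemma le_bot_eq (G : group F) (A : subgroup G) : A <= bot G -> A = bot G.
Proof. intro H; apply (subset_antisym C1); [exact H | apply (bot_least C2)]. Qed.

Lemma meet_le_eq (G : group F) (A B : subgroup G) : A <= B -> meet A B = A.
Proof.
  intro H; apply (subset_antisym C1).
  - apply (proj1 (meet_glb C2 A B (meet A B))), (subset_refl C1).
  - apply (meet_glb C2); split; [apply (subset_refl C1) | exact H].
Qed.

Lemma join_ge_eq (G : group F) (A B : subgroup G) : B <= A -> join A B = A.
Proof.
  intro H; apply (subset_antisym C1).
  - apply (join_lub C2); split; [apply (subset_refl C1) | exact H].
  - apply (proj1 (join_lub C2 A B (join A B))), (subset_refl C1).
Qed.

Lemma direct_bot (X Y : group F) (f : hom X Y) : direct f (bot X) = bot Y.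
Proof. apply le_bot_eq, (galois C1), (bot_least C2). Qed.

Lemma inverse_top (X Y : group F) (f : hom X Y) : inverse f (top Y) = top X.
Proof. apply top_le_eq, (galois C1), (top_greatest C2). Qed.

Lemma directK (X Y : group F) (f : hom X Y) (A : subgroup X) :
  Ker f = bot X -> inverse f (direct f A) = A.
Proof.
  intro H; rewrite (inverse_direct C2), H; apply join_ge_eq, (bot_least C2).
Qed.

Lemma inverseK (X Y : group F) (f : hom X Y) (B : subgroup Y) :
  Im f = top Y -> direct f (inverse f B) = B.
Proof.
  intro H; rewrite (direct_inverse C2), H; apply meet_le_eq, (top_greatest C2).
Qed.

Lemma Im_comp_le (X Y Z : group F) (g : hom Y Z) (f : hom X Y) : Im (g * f) <= Im g.
Proof. unfold Im; rewrite <- (direct_comp C1); apply direct_mono, (top_greatest C2). Qed.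

Lemma Ker_le_comp (X Y Z : group F) (g : hom Y Z) (f : hom X Y) : Ker f <= Ker (g * f).
Proof. unfold Ker; rewrite <- (inverse_comp C1); apply inverse_mono, (bot_least C2). Qed.

Lemma Im_id (G : group F) : Im (idhom G) = top G.
Proof. apply (direct_id C1). Qed.

Lemma Ker_id (G : group F) : Ker (idhom G) = bot G.
Proof. apply (inverse_id C1). Qed.

Lemma normal_Ker (X Y : group F) (f : hom X Y) : normal (Ker f).
Proof. exists Y, f; reflexivity. Qed.

Lemma conormal_Im (X Y : group F) (f : hom X Y) : conormal (Im f).
Proof. exists X, f; reflexivity. Qed.

(** * Projections, embeddings and isomorphisms *)

Lemma projection_epi (G E E' : group F) (S : subgroup G) (e : hom G E) (v w : hom E E') :
  projection_of S e -> v * e = w * e -> v = w.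
Proof.
  intros [H1 H2] Hvw; destruct (H2 E' (v * e)) as [u [_ Hu]].
  - exact (subset_trans C1 H1 (Ker_le_comp v e)).
  - rewrite <- (Hu v eq_refl); exact (Hu w Hvw).
Qed.

Lemma embedding_mono (G M M' : group F) (S : subgroup G) (m : hom M G) (v w : hom M' M) :
  embedding_of S m -> m * v = m * w -> v = w.
Proof.
  intros [H1 H2] Hvw; destruct (H2 M' (m * v)) as [u [_ Hu]].
  - exact (subset_trans C1 (Im_comp_le m v) H1).
  - rewrite <- (Hu v eq_refl); exact (Hu w Hvw).
Qed.

(* Writing e = iota h pi with pi the projection associated to Ker e, one also has
   pi = w e, and cancelling e in e = iota h w e shows that iota is split. *)
Lemma projection_Im (G E : group F) (S : subgroup G) (e : hom G E) :
  projection_of S e -> Im e = top E.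
Proof.
  intro He; destruct (axiom4 HF e) as [h [_ Eq]].
  destruct (proj_projection C3 (normal_Ker e)) as [Hp _].
  destruct (emb_embedding C3 (conormal_Im e)) as [Hm _].
  destruct (proj2 He _ (proj (Ker e)) (subset_trans C1 (proj1 He) Hp)) as [w [Hw _]].
  assert (K : emb (Im e) * (h * w) = idhom E).
  { apply (projection_epi He).
    rewrite <- !(comp_assoc C1), <- Hw, <- Eq; symmetry; apply (comp_id_l C1). }
  apply top_le_eq; refine (subset_trans C1 _ Hm).
  rewrite <- Im_id, <- K; apply Im_comp_le.
Qed.

(** Dually, iota = m u, and cancelling m in m = m u h pi gives pi a left inverse, so Ker pi, which
    contains Ker m, is trivial. *)
Lemma embedding_Ker (G M : group F) (S : subgroup G) (m : hom M G) :
  embedding_of S m -> Ker m = bot M.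
Proof.
  intro Hm; destruct (axiom4 HF m) as [h [_ Eq]].
  destruct (proj_projection C3 (normal_Ker m)) as [Hp _].
  destruct (emb_embedding C3 (conormal_Im m)) as [Hi _].
  destruct (proj2 Hm _ (emb (Im m)) (subset_trans C1 Hi (proj1 Hm))) as [u [Hu _]].
  assert (K : (u * h) * proj (Ker m) = idhom M).
  { apply (embedding_mono Hm).
    rewrite !(comp_assoc C1), <- Hu, <- (comp_assoc C1), <- Eq.
    symmetry; apply (comp_id_r C1). }
  apply le_bot_eq; refine (subset_trans C1 Hp _).
  rewrite <- Ker_id, <- K; apply Ker_le_comp.
Qed.

(** A homomorphism with kernel S factors through e, which bounds Ker e by S. *)
Lemma projection_Ker (G E : group F) (S : subgroup G) (e : hom G E) :
  normal S -> projection_of S e -> Ker e = S.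
Proof.
  intros (H & f & ->) [H1 H2]; apply (subset_antisym C1); [|exact H1].
  destruct (H2 H f (subset_refl C1 _)) as [v [-> _]]; apply Ker_le_comp.
Qed.

Lemma embedding_Im (G M : group F) (S : subgroup G) (m : hom M G) :
  conormal S -> embedding_of S m -> Im m = S.
Proof.
  intros (E & f & ->) [H1 H2]; apply (subset_antisym C1); [exact H1|].
  destruct (H2 E f (subset_refl C1 _)) as [v [-> _]]; apply Im_comp_le.
Qed.

Lemma isomorphism_id (G : group F) : isomorphism (idhom G).
Proof. exists (idhom G); split; apply (comp_id_l C1). Qed.

Lemma isomorphism_comp (X Y Z : group F) (g : hom Y Z) (f : hom X Y) :
  isomorphism g -> isomorphism f -> isomorphism (g * f).
Proof.
  intros (g' & Hg1 & Hg2) (f' & Hf1 & Hf2); exists (f' * g'); split.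
  - rewrite <- (comp_assoc C1), (comp_assoc C1 g'), Hg1, (comp_id_l C1); exact Hf1.
  - rewrite <- (comp_assoc C1), (comp_assoc C1 f), Hf2, (comp_id_l C1); exact Hg2.
Qed.

Lemma isomorphism_emb_top (G : group F) : isomorphism (emb (top G)).
Proof.
  (* The normalization is an equality of dependent pairs, so the goal is restated as a predicate on
     pairs before rewriting. *)
  change ((fun p : {M : group F & hom M G} => isomorphism (projT2 p))
            (existT (fun M => hom M G) _ (emb (top G)))).
  rewrite (emb_top C3); apply isomorphism_id.
Qed.

Lemma isomorphism_proj_bot (G : group F) : isomorphism (proj (bot G)).
Proof.
  change ((fun p : {E : group F & hom G E} => isomorphism (projT2 p))
            (existT (fun E => hom G E) _ (proj (bot G)))).
  rewrite (proj_bot C3); apply isomorphism_id.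
Qed.

Lemma isomorphism_of_Ker_Im (X Y : group F) (f : hom X Y) :
  Ker f = bot X -> Im f = top Y -> isomorphism f.
Proof.
  intros HK HI; destruct (axiom4 HF f) as [h [Hh ->]].
  repeat apply isomorphism_comp; [| exact Hh |].
  - rewrite HI; apply isomorphism_emb_top.
  - rewrite HK; apply isomorphism_proj_bot.
Qed.

Lemma projection_iso_comp (G E E' : group F) (S : subgroup G) (e : hom G E)
    (h : hom E E') :
  isomorphism h -> projection_of S e -> projection_of S (h * e).
Proof.
  intros (k & Hk1 & Hk2) He; split.
  - exact (subset_trans C1 (proj1 He) (Ker_le_comp h e)).
  - intros D d Hd; destruct (proj2 He D d Hd) as [v [Hv _]]; exists (v * k); split.
    + rewrite (comp_assoc C1), <- (comp_assoc C1 v), Hk1, (comp_id_r C1); exact Hv.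
    + intros w Hw; rewrite <- (comp_id_r C1 w), <- Hk2, (comp_assoc C1); f_equal.
      apply (projection_epi He); rewrite <- Hv, Hw; apply (comp_assoc C1).
Qed.

Lemma embedding_comp_iso (G M M' : group F) (S : subgroup G) (m : hom M G)
    (h : hom M' M) :
  isomorphism h -> embedding_of S m -> embedding_of S (m * h).
Proof.
  intros (k & Hk1 & Hk2) Hm; split.
  - exact (subset_trans C1 (Im_comp_le m h) (proj1 Hm)).
  - intros D d Hd; destruct (proj2 Hm D d Hd) as [v [Hv _]]; exists (k * v); split.
    + rewrite (comp_assoc C1), <- (comp_assoc C1 m), Hk2, (comp_id_r C1); exact Hv.
    + intros w Hw; rewrite <- (comp_id_l C1 w), <- Hk1, <- (comp_assoc C1); f_equal.
      apply (embedding_mono Hm); rewrite <- Hv, Hw; symmetry; apply (comp_assoc C1).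
Qed.

(** When the image is full, the embedding in Axiom 4 is an isomorphism and is absorbed into the
    projection. This gives a universal property to edges known only by their image. *)
Lemma projection_of_Im_top (X Y : group F) (f : hom X Y) :
  Im f = top Y -> projection_of (Ker f) f.
Proof.
  intro HI; destruct (axiom4 HF f) as [h [Hh Eq]].
  rewrite Eq at 2; rewrite (comp_assoc C1); apply projection_iso_comp.
  - apply isomorphism_comp; [rewrite HI; apply isomorphism_emb_top | exact Hh].
  - apply (proj_projection C3), normal_Ker.
Qed.

Lemma embedding_of_Ker_bot (X Y : group F) (f : hom X Y) :
  Ker f = bot X -> embedding_of (Im f) f.
Proof.
  intro HK; destruct (axiom4 HF f) as [h [Hh Eq]].
  rewrite Eq at 2; apply embedding_comp_iso.
  - apply isomorphism_comp; [exact Hh | rewrite HK; apply isomorphism_proj_bot].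
  - apply (emb_embedding C3), conormal_Im.
Qed.

Lemma hom_factorization (X Y : group F) (f : hom X Y) :
  exists (N : group F) (e : hom X N) (m : hom N Y),
    projection_of (Ker f) e /\ embedding_of (Im f) m /\ f = m * e.
Proof.
  destruct (axiom4 HF f) as [h [Hh Eq]].
  (* The isomorphism of Axiom 4 is put on the projection side. Splitting leaves two clauses for each
     universal property. *)
  exists (emb_dom (Im f)), (h * proj (Ker f)), (emb (Im f)); repeat split; try exact Eq.
  1, 2: apply projection_iso_comp, (proj_projection C3), normal_Ker; exact Hh.
  all: apply (emb_embedding C3), conormal_Im.
Qed.

(** * Chasing across one cell of a pyramid *)

Lemma chase_pushout (T B C U : group F) (a : hom B T) (b : hom B C)
    (x : hom T U) (y : hom C U) (S : subgroup T) :
  Im a = top T -> Im b = top C -> x * a = y * b -> Ker (y * b) <= join (Ker a) (Ker b) ->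
  inverse y (direct x S) = direct b (inverse a S).
Proof.
  intros Ha Hb E K.
  (* As S is the image under a of its preimage, x S = y b (inverse image of S under a); the preimage
     under y then adds only Ker y. *)
  rewrite <- (inverseK S Ha) at 1.
  rewrite (direct_comp C1), E, <- (direct_comp C1), (inverse_direct C2).
  apply join_ge_eq.
  (* Ker y is the image under b of Ker (y b), which lies below Ker a joined with Ker b; the first
     lies in the preimage of S, the second is killed by b. *)
  rewrite <- (inverseK (Ker y) Hb); apply (galois C1).
  unfold Ker at 1; rewrite (inverse_comp C1).
  refine (subset_trans C1 K _).
  apply (join_lub C2); split.
  - apply (subset_trans C1 (B := inverse a S)); [apply inverse_mono, (bot_least C2)|].
    apply (galois C1), (subset_refl C1).
  - apply inverse_mono, (bot_least C2).
Qed.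

(** The order dual of [chase_pushout]: direct and inverse images, kernels and images, joins and
    meets are exchanged. *)
Lemma chase_pullback (T B C U : group F) (a : hom T B) (b : hom C B)
    (x : hom U T) (y : hom U C) (S : subgroup T) :
  Ker a = bot T -> Ker b = bot C -> a * x = b * y -> meet (Im a) (Im b) <= Im (b * y) ->
  direct y (inverse x S) = inverse b (direct a S).
Proof.
  intros Ha Hb E K.
  rewrite <- (directK S Ha) at 1.
  rewrite (inverse_comp C1), E, <- (inverse_comp C1), (direct_inverse C2).
  apply meet_le_eq.
  rewrite <- (directK (Im y) Hb); apply (galois C1).
  unfold Im at 1; rewrite (direct_comp C1).
  refine (subset_trans C1 _ K).
  apply (meet_glb C2); split.
  - apply (subset_trans C1 (B := direct a S)); [|apply direct_mono, (top_greatest C2)].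
    apply (galois C1), (subset_refl C1).
  - apply direct_mono, (top_greatest C2).
Qed.

(* Read from left to right, an upward edge is a right-pointing arrow with full
   image or a left-pointing one with trivial kernel; since [direct] preserves bot and
   [inverse] preserves top, both cases are captured by the same two equations. *)
Definition ascending (A B : group F) (a : arrow A B) : Prop :=
  push a (top A) = top B /\ push a (bot A) = bot B.

Definition descending (A B : group F) (a : arrow A B) : Prop :=
  pull a (top B) = top A /\ pull a (bot B) = bot A.

Lemma ascendingK (A B : group F) (a : arrow A B) (S : subgroup B) :
  ascending a -> push a (pull a S) = S.
Proof.
  destruct a as [f|f]; intros [H1 H2]; simpl in *;
    [now apply inverseK | now apply directK].
Qed.

Lemma descendingK (A B : group F) (a : arrow A B) (S : subgroup A) :
  descending a -> pull a (push a S) = S.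
Proof.
  destruct a as [f|f]; intros [H1 H2]; simpl in *;
    [now apply directK | now apply inverseK].
Qed.

Lemma ascending_rightw (A B : group F) (f : hom A B) :
  Im f = top B -> ascending (rightw f).
Proof. split; [exact H | apply direct_bot]. Qed.

Lemma ascending_leftw (A B : group F) (f : hom B A) :
  Ker f = bot B -> ascending (leftw f).
Proof. split; [apply inverse_top | exact H]. Qed.

Lemma descending_rightw (A B : group F) (f : hom A B) :
  Ker f = bot A -> descending (rightw f).
Proof. split; [apply inverse_top | exact H]. Qed.

Lemma descending_leftw (A B : group F) (f : hom B A) :
  Im f = top A -> descending (leftw f).
Proof. split; [exact H | apply direct_bot]. Qed.

Lemma factorization_edges (A N B : group F) (f : arrow A B) (l : arrow A N)
    (r : arrow N B) :
  factorization f l r -> ascending l /\ descending r.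
Proof.
  intros [c e m He Hm _ | c e m He Hm _].
  - split; [exact (ascending_rightw (projection_Im He))
           | exact (descending_rightw (embedding_Ker Hm))].
  - split; [exact (ascending_leftw (embedding_Ker Hm))
           | exact (descending_leftw (projection_Im He))].
Qed.

Lemma factorization_chase (A N B : group F) (f : arrow A B) (l : arrow A N)
    (r : arrow N B) :
  factorization f l r ->
  (forall S, push r (push l S) = push f S) /\ (forall S, pull l (pull r S) = pull f S).
Proof.
  intros [c e m _ _ -> | c e m _ _ ->]; simpl; split; intro S;
    first [apply (direct_comp C1) | apply (inverse_comp C1)].
Qed.

Lemma factorization_exists (A B : group F) (f : arrow A B) :
  exists (N : group F) (l : arrow A N) (r : arrow N B), factorization f l r.
Proof.
  destruct f as [c|c]; destruct (hom_factorization c) as (N & e & m & He & Hm & E).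
  - exists N, (rightw e), (rightw m); now constructor.
  - exists N, (leftw m), (leftw e); now constructor.
Qed.

Lemma square_edges (T B C U : group F) (r : arrow T B) (l : arrow B C)
    (l' : arrow T U) (r' : arrow U C) :
  square r l l' r' -> ascending l' /\ descending r'.
Proof.
  intros [a b p x y Hp <- Ey | a b q x y Hq <- Ey | a b l1 r1 Hf | a b l1 r1 Hf].
  - assert (Ip := projection_Im Hp); split.
    + apply ascending_rightw, top_le_eq; rewrite <- Ip; apply Im_comp_le.
    + apply descending_leftw, top_le_eq; rewrite <- Ip, <- Ey; apply Im_comp_le.
  - assert (Kq := embedding_Ker Hq); split.
    + apply ascending_leftw, le_bot_eq; rewrite <- Kq; apply Ker_le_comp.
    + apply descending_rightw, le_bot_eq; rewrite <- Kq, <- Ey; apply Ker_le_comp.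
  - exact (factorization_edges Hf).
  - exact (factorization_edges Hf).
Qed.

(** For wedges whose edges both point up or both point down, the edge hypotheses are what
    [chase_pushout] and [chase_pullback] require; the mixed wedges only need functoriality of
    images. *)
Lemma square_chase (T B C U : group F) (r : arrow T B) (l : arrow B C)
    (l' : arrow T U) (r' : arrow U C) :
  square r l l' r' -> descending r -> ascending l ->
  (forall S, push r' (push l' S) = push l (push r S)) /\
  (forall S, pull l' (pull r' S) = pull r (pull l S)).
Proof.
  intros [a b p x y Hp Ex Ey | a b q x y Hq Ex Ey | a b l1 r1 Hf | a b l1 r1 Hf]
    [Hr1 Hr2] [Hl1 Hl2]; simpl in *.
  - assert (Kp := projection_Ker (axiom5_join HF (normal_Ker a) (normal_Ker b)) Hp).
    assert (E : x * a = y * b) by congruence.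
    split; intro S; apply chase_pushout; auto.
    + rewrite Ey, Kp; apply (subset_refl C1).
    (* Backward chasing uses the same lemma with a and b exchanged, so the join must be commuted. *)
    + rewrite Ex, Kp; apply (join_lub C2); split;
        apply (proj1 (join_lub C2 (Ker b) (Ker a) _) (subset_refl C1 _)).
  - assert (Iq := embedding_Im (axiom5_meet HF (conormal_Im a) (conormal_Im b)) Hq).
    assert (E : a * x = b * y) by congruence.
    split; intro S; apply chase_pullback; auto.
    + rewrite Ey, Iq; apply (subset_refl C1).
    + rewrite Ex, Iq; apply (meet_glb C2); split;
        apply (proj1 (meet_glb C2 (Im b) (Im a) _) (subset_refl C1 _)).
  - destruct (factorization_chase Hf) as [H1 H2]; split; intro S.
    + rewrite H1; symmetry; apply (direct_comp C1).
    + rewrite H2; symmetry; apply (inverse_comp C1).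
  - destruct (factorization_chase Hf) as [H1 H2]; split; intro S.
    + rewrite H1; symmetry; apply (inverse_comp C1).
    + rewrite H2; symmetry; apply (direct_comp C1).
Qed.

Lemma square_exists (T B C : group F) (r : arrow T B) (l : arrow B C) :
  descending r -> ascending l ->
  exists (U : group F) (l' : arrow T U) (r' : arrow U C), square r l l' r'.
Proof.
  intros [Hr1 Hr2] [Hl1 Hl2]; destruct r as [a|a]; destruct l as [b|b]; simpl in *.
  - destruct (factorization_exists (rightw (b * a))) as (U & l' & r' & Hf).
    exists U, l', r'; now constructor.
  - pose (M := meet (Im a) (Im b)).
    assert (Hq : embedding_of M (emb M))
      by (apply (emb_embedding C3), (axiom5_meet HF); apply conormal_Im).
    destruct (proj1 (meet_glb C2 (Im a) (Im b) _) (proj1 Hq)) as [Qa Qb].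
    (* Having trivial kernels, the wedge edges are embeddings associated to their images, so [emb M]
       factors through both. *)
    destruct (proj2 (embedding_of_Ker_bot Hr2) _ _ Qa) as [x [Hx _]].
    destruct (proj2 (embedding_of_Ker_bot Hl2) _ _ Qb) as [y [Hy _]].
    exists (emb_dom M), (leftw x), (rightw y); exact (square_down Hq (eq_sym Hx) (eq_sym Hy)).
  - pose (M := join (Ker a) (Ker b)).
    assert (Hp : projection_of M (proj M))
      by (apply (proj_projection C3), (axiom5_join HF); apply normal_Ker).
    destruct (proj1 (join_lub C2 (Ker a) (Ker b) _) (proj1 Hp)) as [Pa Pb].
    destruct (proj2 (projection_of_Im_top Hr1) _ _ Pa) as [x [Hx _]].
    destruct (proj2 (projection_of_Im_top Hl1) _ _ Pb) as [y [Hy _]].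
    exists (proj_cod M), (rightw x), (leftw y); exact (square_up Hp (eq_sym Hx) (eq_sym Hy)).
  - destruct (factorization_exists (leftw (a * b))) as (U & l' & r' & Hf).
    exists U, l', r'; now constructor.
Qed.

(** * Strips and whole pyramids *)

Fixpoint all_arrows (P : forall A B : group F, arrow A B -> Prop)
    (A B : group F) (Z : zigzag A B) : Prop :=
  match Z with
  | znil _ => True
  | zcons a Z' => P _ _ a /\ all_arrows P Z'
  end.

Lemma all_arrows_cat (P : forall A B : group F, arrow A B -> Prop)
    (A B C : group F) (Z : zigzag A B) (Z' : zigzag B C) :
  all_arrows P Z -> all_arrows P Z' -> all_arrows P (zcat Z Z').
Proof. induction Z; simpl; [|intros []]; auto. Qed.

Lemma strip_edges (T B U C : group F) (r : arrow T B) (D : zigzag B C)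
    (D' : zigzag T U) (r' : arrow U C) :
  strip r D D' r' -> descending r -> all_arrows ascending D ->
  all_arrows ascending D' /\ descending r'.
Proof.
  induction 1 as [T B r | T B C U C' U' r l l' r' D D' r1 Hs _ IH]; intros Hr HD; simpl in *.
  - auto.
  - destruct HD as [_ HD], (square_edges Hs) as [Hl' Hr'], (IH Hr' HD); auto.
Qed.

(** Cell by cell: the upper right edge of a cell descends, so it can start the wedge of the next
    cell. *)
Lemma strip_chase (T B U C : group F) (r : arrow T B) (D : zigzag B C)
    (D' : zigzag T U) (r' : arrow U C) :
  strip r D D' r' -> descending r -> all_arrows ascending D ->
  (forall S, push r' (chase D' S) = chase D (push r S)) /\
  (forall S, chase_back D' (pull r' S) = pull r (chase_back D S)).
Proof.
  induction 1 as [T B r | T B C U C' U' r l l' r' D D' r1 Hs _ IH]; intros Hr HD; simpl in *.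
  - auto.
  - destruct HD as [Hl HD], (square_edges Hs) as [_ Hr'].
    destruct (square_chase Hs Hr Hl) as [E1 E2], (IH Hr' HD) as [I1 I2].
    split; intro S.
    + rewrite I1, E1; reflexivity.
    + rewrite I2, E2; reflexivity.
Qed.

Lemma strip_exists (B C : group F) (D : zigzag B C) :
  forall (T : group F) (r : arrow T B), descending r -> all_arrows ascending D ->
  exists (U : group F) (D' : zigzag T U) (r' : arrow U C), inhabited (strip r D D' r').
Proof.
  induction D as [B | B C C' l D IH]; intros T r Hr HD; simpl in *.
  - exists T, (znil T), r; constructor; constructor.
  - destruct HD as [Hl HD], (square_exists Hr Hl) as (U & l' & r' & Hs).
    destruct (IH U r' (proj2 (square_edges Hs)) HD) as (U' & D' & r1 & [Hst]).
    exists U', (zcons l' D'), r1; constructor; exact (strip_cons Hs Hst).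
Qed.

Lemma pyramid_sides (A T B : group F) (Z : zigzag A B) (L : zigzag A T)
    (R : zigzag T B) :
  pyramid Z L R -> all_arrows ascending L /\ all_arrows descending R.
Proof.
  induction 1 as [A | A N B C T U f l r Z L R L' r' Hf _ [HL HR] Hst]; simpl; auto.
  destruct (factorization_edges Hf) as [Hl Hr], (strip_edges Hst Hr HL); auto.
Qed.

(** The first arrow is replaced by l followed by r; the strip then carries r along L to the edge r'
    at the apex. *)
Lemma pyramid_chase (A T B : group F) (Z : zigzag A B) (L : zigzag A T)
    (R : zigzag T B) :
  pyramid Z L R ->
  (forall S, chase R (chase L S) = chase Z S) /\
  (forall S, chase_back L (chase_back R S) = chase_back Z S).
Proof.
  induction 1 as [A | A N B C T U f l r Z L R L' r' Hf P [I1 I2] Hst]; simpl; auto.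
  destruct (factorization_edges Hf) as [Hl Hr], (factorization_chase Hf) as [E1 E2].
  destruct (strip_chase Hst Hr (proj1 (pyramid_sides P))) as [S1 S2].
  split; intro S.
  - rewrite S1, I1, E1; reflexivity.
  - rewrite S2, I2, E2; reflexivity.
Qed.

Lemma pyramid_exists (A B : group F) (Z : zigzag A B) :
  exists (T : group F) (L : zigzag A T) (R : zigzag T B), inhabited (pyramid Z L R).
Proof.
  induction Z as [A | A B C f Z (T & L & R & [P])].
  - exists A, (znil A), (znil A); constructor; constructor.
  - destruct (factorization_exists f) as (N & l & r & Hf).
    destruct (strip_exists (proj2 (factorization_edges Hf)) (proj1 (pyramid_sides P)))
      as (U & L' & r' & [Hst]).
    exists U, (zcons l L'), (zcons r' R); constructor; exact (pyramid_cons Hf P Hst).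
Qed.

(** * Extreme subgroups and isomorphic edges *)

Lemma ascending_chase_extremes (A B : group F) (Z : zigzag A B) :
  all_arrows ascending Z -> chase Z (top A) = top B /\ chase Z (bot A) = bot B.
Proof.
  induction Z; simpl; auto.
  intros [[H1 H2] H]; rewrite H1, H2; auto.
Qed.

Lemma descending_chase_extremes (A B : group F) (Z : zigzag A B) :
  all_arrows descending Z -> chase_back Z (top B) = top A /\ chase_back Z (bot B) = bot A.
Proof.
  induction Z as [|A B C a Z IH]; simpl; auto.
  intros [[H1 H2] H]; destruct (IH H) as [-> ->]; auto.
Qed.

Lemma descending_chaseK (A B : group F) (Z : zigzag A B) (S : subgroup A) :
  all_arrows descending Z -> chase_back Z (chase Z S) = S.
Proof.
  revert S; induction Z as [|A B C a Z IH]; simpl; auto.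
  intros S [Ha H]; rewrite IH by exact H; exact (descendingK S Ha).
Qed.

Definition iso_arrow (A B : group F) (a : arrow A B) : Prop :=
  match a with rightw f => isomorphism f | leftw f => isomorphism f end.

Lemma iso_arrow_of_extremes (A B : group F) (a : arrow A B) :
  ascending a -> descending a -> iso_arrow a.
Proof.
  destruct a as [f|f]; intros [H1 H2] [H3 H4]; now apply isomorphism_of_Ker_Im.
Qed.

Lemma ascending_iso (A B : group F) (Z : zigzag A B) :
  all_arrows ascending Z ->
  chase_back Z (top B) = top A -> chase_back Z (bot B) = bot A ->
  all_arrows iso_arrow Z.
Proof.
  induction Z as [|A B C a Z IH]; simpl; auto.
  intros [Ha HZ] Ht Hb.
  (* Pushing the hypothesis forward along a undoes the last pull, so the tail preserves the extremes
     too, and a also descends. *)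
  assert (Et : chase_back Z (top C) = top B)
    by (rewrite <- (ascendingK (chase_back Z (top C)) Ha), Ht; apply Ha).
  assert (Eb : chase_back Z (bot C) = bot B)
    by (rewrite <- (ascendingK (chase_back Z (bot C)) Ha), Hb; apply Ha).
  rewrite Et in Ht; rewrite Eb in Hb.
  split; [apply iso_arrow_of_extremes; [exact Ha | split; assumption] | auto].
Qed.

Lemma descending_iso (A B : group F) (Z : zigzag A B) :
  all_arrows descending Z ->
  chase Z (top A) = top B -> chase Z (bot A) = bot B ->
  all_arrows iso_arrow Z.
Proof.
  induction Z as [|A B C a Z IH]; simpl; auto.
  intros [Ha HZ] Ht Hb; destruct (descending_chase_extremes HZ) as [Dt Db].
  (* Chasing back along the tail undoes the forward chase and preserves the extremes, so a itself
     preserves them forward. *)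
  assert (Et : push a (top A) = top B)
    by (rewrite <- (descending_chaseK (push a (top A)) HZ), Ht; exact Dt).
  assert (Eb : push a (bot A) = bot B)
    by (rewrite <- (descending_chaseK (push a (bot A)) HZ), Hb; exact Db).
  rewrite Et in Ht; rewrite Eb in Hb.
  split; [apply iso_arrow_of_extremes; [split; assumption | exact Ha] | auto].
Qed.

Lemma iso_zigzag_collapsible (A B : group F) (Z : zigzag A B) :
  all_arrows iso_arrow Z -> collapsible Z.
Proof.
  induction Z as [|A B C [f|f] Z IH]; simpl; auto; intros []; auto.
Qed.

Lemma collapsible_composite (A B : group F) (Z : zigzag A B) :
  collapsible Z -> exists h : hom A B, composite Z h.
Proof.
  induction Z as [A|A B C [f|f] Z IH]; simpl.
  - exists (idhom A); constructor.
  - intros [_ H]; destruct (IH H) as [h Hh]; exists (h * f); now constructor.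
  - intros [[g Hg] H]; destruct (IH H) as [h Hh]; exists (h * g); now constructor.
Qed.

Lemma iso_zigzag_composite (A B : group F) (Z : zigzag A B) (h : hom A B) :
  composite Z h -> all_arrows iso_arrow Z -> isomorphism h.
Proof.
  induction 1 as [A | A B C f Z h _ IH | A B C f g Z h [Hg1 Hg2] _ IH]; simpl.
  - intros _; apply isomorphism_id.
  - intros [Hf HZ]; apply isomorphism_comp; auto.
  - intros [Hf HZ]; apply isomorphism_comp; [auto | exists f; split; assumption].
Qed.

(** Each side inherits preservation in its missing direction from the whole chase, the other side
    already preserving the extremes in that direction. *)
Lemma principal_iso (A T B : group F) (Z : zigzag A B) (L : zigzag A T)
    (R : zigzag T B) (P : pyramid Z L R) :
  chase Z (bot A) = bot B -> chase Z (top A) = top B ->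
  chase_back Z (bot B) = bot A -> chase_back Z (top B) = top A ->
  all_arrows iso_arrow (principal P).
Proof.
  destruct (pyramid_sides P) as [HL HR], (pyramid_chase P) as [E1 E2].
  destruct (ascending_chase_extremes HL) as [Lt Lb].
  destruct (descending_chase_extremes HR) as [Rt Rb].
  intros cb ct bb bt; apply all_arrows_cat.
  (* An extreme subgroup of the apex is rewritten as one of B chased back along R. *)
  - apply (ascending_iso HL); [rewrite <- Rt | rewrite <- Rb]; now rewrite E2.
  - apply (descending_iso HR); [rewrite <- Lt | rewrite <- Lb]; now rewrite E1.
Qed.

End Noetherian.

Theorem corollary3p4 (F : form) (HF : noetherian_form F)
    (X0 Xn : group F) (Z : zigzag X0 Xn) (n_ge1 : 1 <= zlength Z)
    (chase_bot : chase Z (bot X0) = bot Xn)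
    (chase_top : chase Z (top X0) = top Xn)
    (chase_back_bot : chase_back Z (bot Xn) = bot X0)
    (chase_back_top : chase_back Z (top Xn) = top X0) :
  induces_homomorphism Z /\
  (exists h : hom X0 Xn, induced_homomorphism Z h) /\
  (forall h : hom X0 Xn, induced_homomorphism Z h -> isomorphism h).
Proof.
  destruct (pyramid_exists HF Z) as (T & L & R & [P]).
  assert (K : collapsible (principal P))
    by (apply iso_zigzag_collapsible, principal_iso; assumption).
  repeat split.
  - exists T, L, R, P; exact K.
  - destruct (collapsible_composite K) as [h Hh].
    exists h, T, L, R, P; split; assumption.
  (* This h may come from a pyramid other than P; [principal_iso] covers every pyramid over Z. *)
  - intros h (T' & L' & R' & P' & _ & Hh).
    apply (iso_zigzag_composite HF Hh), principal_iso; assumption.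
Qed.
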